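(* Let $A = \sum\{t_i : i \in \omega\}$ and $B = \sum\{u_i : i \in \omega\}$ be special monomial sums, where there are natural numbers $m_i, n_i$ such that for each $i$, $t_i$ is $\omega^{m_i}$ or $(\omega^* )^{m_i}$ and $u_i$ is $\omega^{n_i}$ or $(\omega^* )^{n_i}$. Then $A \cong B$ if and only if $A \equiv B$.
   Context: $\omega^*$ is the reverse of $\omega$; $\omega^m$ and $(\omega^* )^m$ are the ordinal power and its reverse, with $\omega^0 = (\omega^* )^0 = 1$ the one-point order. $\sum\{t_i : i \in \omega\}$ denotes the concatenation $t_0 + t_1 + t_2 + \cdots$. A monomial sum (here over index set $\omega$) is such a sum in which, whenever $M$ and $N$ are consecutive terms, $M + N$ is isomorphic to neither $M$ nor $N$. It is special if no three consecutive terms are of the form $\omega, \omega^*, \omega^m$ or $(\omega^* )^m, \omega, \omega^*$ for any $m \ge 1$. $\equiv$ denotes elementary equivalence of linear orders (equivalently, player II wins the $n$-move Ehrenfeucht–Fraïssé game for every $n$). *)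

(* Defs.v *)
From mathcomp Require Import all_boot all_order.

Set Implicit Arguments.
Unset Strict Implicit.
Unset Printing Implicit Defensive.

Import Order.Theory.

Definition order_iso (d d' : Order.disp_t)
    (T : orderType d) (T' : orderType d') : Prop :=
  exists f : T -> T', bijective f /\ {mono f : x y / (x <= y)%O}.

(* First-order formulas over the signature {<} with equality.  [formula V] has
   its free variables in [V]; the bound variable of [Forall] is [None], so
   sentences are the formulas over the empty type.  [False], [->] and [forall]
   are complete for classical first-order logic. *)
Inductive formula (V : Type) : Type :=
  | Lt of V & V
  | Eq of V & V
  | Bot
  | Imp of formula V & formula V
  | Forall of formula (option V).

Arguments Bot {V}.

Fixpoint sat (d : Order.disp_t) (T : orderType d) (V : Type)
    (v : V -> T) (phi : formula V) {struct phi} : Prop :=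
  match phi with
  | Lt i j => (v i < v j)%O
  | Eq i j => v i = v j
  | Bot => False
  | Imp p q => sat v p -> sat v q
  | Forall p => forall x : T, sat (oapp v x) p
  end.

Definition models (d : Order.disp_t) (T : orderType d)
    (phi : formula void) : Prop :=
  sat (@of_void T) phi.

Definition elem_equiv (d d' : Order.disp_t)
    (T : orderType d) (T' : orderType d') : Prop :=
  forall phi : formula void, models T phi <-> models T' phi.

(* The ordinal power omega^m: m-tuples of naturals ordered lexicographically,
   the head being the most significant entry (the coefficient of omega^(m-1)
   in Cantor normal form). *)
Definition omega_pow (m : nat) : orderType _ := m.-tuplelexi nat.

Definition omega_pow_rev (m : nat) : orderType _ := (omega_pow m)^d%type.

(* Dependent pairs carry MathComp's lexicographic order, first component
   first, so these are the ordered sums M + N (as false < true) and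
   t 0 + t 1 + t 2 + ... *)
Definition osum2 (d : Order.disp_t) (M N : orderType d) : orderType d :=
  {b : bool & if b then N else M}.

Definition osum (d : Order.disp_t) (t : nat -> orderType d) : orderType d :=
  {i : nat & t i}.

Definition monomial_sum (d : Order.disp_t) (t : nat -> orderType d) : Prop :=
  forall i, ~ order_iso (osum2 (t i) (t i.+1)) (t i) /\
            ~ order_iso (osum2 (t i) (t i.+1)) (t i.+1).

Definition special (d : Order.disp_t) (t : nat -> orderType d) : Prop :=
  forall i m, 0 < m ->
    ~ [/\ order_iso (t i) nat, order_iso (t i.+1) nat^d
        & order_iso (t i.+2) (omega_pow m)] /\
    ~ [/\ order_iso (t i) (omega_pow_rev m), order_iso (t i.+1) nat
        & order_iso (t i.+2) nat^d].

(* Main.v *)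
Require Import Defs.
From mathcomp Require Import all_boot all_order.
From mathcomp Require Import boolp.

(* The terms of a special monomial sum are read off its theory from left to
   right.  Iterated limits from the left ("limits of limits of ...") are first
   order and measure the exponents: omega^a is a well-order in which limits of
   rank < a are cofinal and no point is a limit of rank a, whereas points of
   reversed powers have predecessors.  The theory thus determines the first
   term, and it defines the segment after that term, so that the remaining
   sums are elementarily equivalent too.  Two cuts need care.  The cut between
   omega and its reverse is not definable, but a sum starting with these two terms
   is recognizable because the third term is then a reversed power, and both
   terms are removed together.  The cut between a reversed power and a power
   omega^b is definable only up to finitely many points of omega^b, which is
   enough because 1 + omega^b is isomorphic to omega^b. *)

Set Implicit Arguments.
Unset Strict Implicit.
Unset Printing Implicit Defensive.

Import Order.Theory.

Local Open Scope order_scope.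

(** * Definable properties *)

(** Properties are semantic and range over all orders at once: one formula then serves both sums,
    and definability follows from closure rules without writing formulas down. *)
Definition definable (V : Type)
    (Q : forall d (T : orderType d), (V -> T) -> Prop) : Prop :=
  exists phi : formula V, forall d (T : orderType d) (v : V -> T),
    sat v phi <-> Q d T v.

Lemma definable_lt V (i j : V) : definable (fun _ _ v => v i < v j).
Proof. by exists (Lt i j). Qed.

Lemma definable_false V : definable (V := V) (fun _ _ _ => False).
Proof. by exists Bot. Qed.

Lemma definable_imp V P Q : definable (V := V) P -> definable Q ->
  definable (fun d T v => P d T v -> Q d T v).
Proof.
move=> [p hp] [q hq]; exists (Imp p q) => d T v /=.
by split=> H /hp/H/hq.
Qed.

Lemma definable_ext V P Q : (forall d (T : orderType d) (v : V -> T),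
  P d T v <-> Q d T v) -> definable P -> definable Q.
Proof. by move=> PQ [p hp]; exists p => d T v; rewrite hp PQ. Qed.

Lemma definable_not V P : definable (V := V) P ->
  definable (fun d T v => ~ P d T v).
Proof. by move=> [p hp]; exists (Imp p Bot) => d T v /=; rewrite hp. Qed.

Lemma definable_true V : definable (V := V) (fun _ _ _ => True).
Proof. by exists (Imp Bot Bot) => d T v; split=> // _ []. Qed.

Lemma definable_and V P Q : definable (V := V) P -> definable Q ->
  definable (fun d T v => P d T v /\ Q d T v).
Proof.
move=> hP hQ.
apply: definable_ext (definable_not (definable_imp hP (definable_not hQ))).
move=> d T v; split=> [H|[p q]]; last by move=> /(_ p).
by split; apply: contrapT => n; apply: H.
Qed.

Lemma definable_forall V (Q : forall d (T : orderType d), (V -> T) -> T -> Prop) :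
  definable (V := option V) (fun d T w => Q d T (fun i => w (Some i)) (w None)) ->
  definable (fun d T v => forall x, Q d T v x).
Proof.
move=> [phi H]; exists (Forall phi) => d T v /=.
by split=> Hx x; apply/(H _ _ (oapp v x)); apply: Hx.
Qed.

Lemma definable_exists V (Q : forall d (T : orderType d), (V -> T) -> T -> Prop) :
  definable (V := option V) (fun d T w => Q d T (fun i => w (Some i)) (w None)) ->
  definable (fun d T v => exists x, Q d T v x).
Proof.
move=> hQ.
have := definable_not (definable_forall (Q := fun d T v x => ~ Q d T v x)
  (definable_not hQ)).
apply: definable_ext => d T v; split=> [/existsNP[x /contrapT]|[x Qx]].
  by exists x.
by move=> /(_ x).
Qed.

Lemma definable_le V (i j : V) : definable (fun _ _ v => v i <= v j).
Proof.
apply: definable_ext (definable_not (definable_lt j i)) => d T v.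
by rewrite leNgt; split=> /negP.
Qed.

Lemma elem_equiv_definable d d' (T : orderType d) (T' : orderType d')
    (Q : forall d (T : orderType d), Prop) :
  elem_equiv T T' -> definable (V := void) (fun d T _ => Q d T) ->
  Q d T -> Q d' T'.
Proof. by move=> TT' [phi H] /(H _ _ (@of_void T))/TT'/H. Qed.

Lemma elem_equiv_sym d d' (T : orderType d) (T' : orderType d') :
  elem_equiv T T' -> elem_equiv T' T.
Proof. by move=> TT' phi; rewrite TT'. Qed.

(** * Relativization to definable subsets *)

Fixpoint rsat (d : Order.disp_t) (T : orderType d) (S : T -> Prop) (V : Type)
    (v : V -> T) (phi : formula V) {struct phi} : Prop :=
  match phi with
  | Lt i j => v i < v j
  | Eq i j => v i = v j
  | Bot => False
  | Imp p q => rsat S v p -> rsat S v q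
  | Forall p => forall x : T, S x -> rsat S (oapp v x) p
  end.

Lemma rsat_embed d d' (T' : orderType d') (T : orderType d) (f : T' -> T)
    (S : T -> Prop) V (v : V -> T') (phi : formula V) :
  {mono f : x y / x < y} -> (forall x, S x <-> exists y, x = f y) ->
  sat v phi <-> rsat S (f \o v) phi.
Proof.
move=> fmono fS.
have finj : injective f.
  by move=> x y fxy; case: (ltgtP x y) => //; rewrite -fmono fxy ltxx.
elim: phi v => {V} [V i j|V i j|V|V p IHp q IHq|V p IHp] v //=.
- by rewrite fmono.
- by split=> [->|/finj].
- by rewrite IHp IHq.
split=> H x; last first.
  apply/IHp; have /H : S (f x) by apply/fS; exists x.
  by congr rsat; apply: funext; case.
move=> /fS[y ->]; have /IHp := H y.
by congr rsat; apply: funext; case.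
Qed.

Lemma models_embed d d' (T' : orderType d') (T : orderType d) (f : T' -> T)
    (S : T -> Prop) (phi : formula void) :
  {mono f : x y / x < y} -> (forall x, S x <-> exists y, x = f y) ->
  models T' phi <-> rsat S (@of_void T) phi.
Proof.
move=> fmono fS; rewrite /models (rsat_embed _ _ fmono fS).
by split; congr rsat; apply: funext; case.
Qed.

(** Induction on [psi] with the environment split in two: [p] locates the parameters of [D], and [q]
    the variables of [psi]. Under a binder [p] is shifted and [q] sends the new variable to
    [None]. *)
Lemma definable_rsat U (D : forall d (T : orderType d), (U -> T) -> T -> Prop)
    W (psi : formula W) V (p : U -> V) (q : W -> V) :
  (forall V (p : U -> V) (i : V),
    definable (fun d T v => D d T (fun u => v (p u)) (v i))) ->
  definable (fun d T (v : V -> T) => rsat (D d T (fun u => v (p u)))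
    (fun w => v (q w)) psi).
Proof.
move=> hD.
elim: psi V p q => {W} [W i j|W i j|W|W f IHf g IHg|W f IHf] V p q /=.
- exact: definable_lt.
- by exists (Eq (q i) (q j)).
- exact: definable_false.
- exact: definable_imp.
apply: definable_forall; apply: definable_imp; first exact: (hD _ (Some \o p)).
have := IHf _ (Some \o p) (oapp (Some \o q) None).
apply: definable_ext => d T v.
suff -> : (fun w => v (oapp (Some \o q) None w)) =
  oapp (fun w => v (Some (q w))) (v None) by [].
by apply: funext; case.
Qed.

(** This is the tool for cutting off terms: a sentence holds in [A'] exactly when its relativization
    to [D] holds in [A], and that relativization is one and the same sentence for [A] and [B]. *)
Lemma elem_equiv_restrict d1 d2 d1' d2' (A : orderType d1) (B : orderType d2)
    (A' : orderType d1') (B' : orderType d2') (f : A' -> A) (g : B' -> B)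
    (D : forall d (T : orderType d), T -> Prop) :
  (forall V (i : V), definable (fun d T v => D d T (v i))) ->
  {mono f : x y / x < y} -> (forall x, D _ _ x <-> exists y, x = f y) ->
  {mono g : x y / x < y} -> (forall x, D _ _ x <-> exists y, x = g y) ->
  elem_equiv A B -> elem_equiv A' B'.
Proof.
move=> hD fm fD gm gD AB phi.
rewrite (models_embed _ fm fD) (models_embed _ gm gD).
have hr := @definable_rsat void (fun d T _ => D d T) void phi void
  (@of_void void) (@of_void void) (fun V _ i => hD V i).
have {}hr : definable (V := void)
    (fun d T _ => rsat (D d T) (@of_void T) phi).
  apply: definable_ext hr => d T v.
  by suff -> : (fun w => v (of_void void w)) = of_void T by []; apply: funext; case.
have BA := elem_equiv_sym AB; split.
- by apply: (elem_equiv_definable (Q := fun d T => rsat (D d T) (@of_void T) phi) AB).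
- by apply: (elem_equiv_definable (Q := fun d T => rsat (D d T) (@of_void T) phi) BA).
Qed.

Lemma elem_equiv_iso d d' (T : orderType d) (T' : orderType d') :
  order_iso T T' -> elem_equiv T T'.
Proof.
move=> [f [[g gK fK] fmono]] phi.
(* An isomorphism is an embedding onto the whole order, and relativizing to the whole order changes
   nothing. *)
rewrite (@models_embed _ _ T T' f (fun=> True)); last 1 first.
- by move=> x; split=> // _; exists (g x).
- have: forall V (v : V -> T') (psi : formula V),
      sat v psi <-> rsat (fun=> True) v psi.
    move=> V v psi; elim: psi v => //= {}V.
    + by move=> p IHp q IHq v; rewrite IHp IHq.
    + by move=> p IHp v; split=> [H x _|H x]; apply/IHp; exact: H.
  by move=> <-.
- exact: leW_mono.
Qed.

(** * Limit points *)

(** In an ordinal and for [k > 0], these are the nonzero multiples of $\omega^k$. Demanding a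
    smaller point keeps a least element from being a limit vacuously. *)
Fixpoint llim (k : nat) (d : Order.disp_t) (T : orderType d) (x : T) : Prop :=
  if k is j.+1 then
    (exists y, y < x) /\
    (forall y, y < x -> exists z, y < z /\ z < x /\ llim j z)
  else True.

Definition rlim (k : nat) (d : Order.disp_t) (T : orderType d) (x : T) : Prop :=
  @llim k _ T^d x.

Definition has_succ (d : Order.disp_t) (T : orderType d) (x : T) : Prop :=
  exists y, x < y /\ forall z, x < z -> y <= z.

Definition has_pred (d : Order.disp_t) (T : orderType d) (x : T) : Prop :=
  exists y, y < x /\ forall z, z < x -> z <= y.

Lemma rlimS k d (T : orderType d) (x : T) :
  rlim k.+1 x <-> (exists y, x < y) /\
    (forall y, x < y -> exists z, z < y /\ x < z /\ rlim k z).
Proof. by []. Qed.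

Lemma definable_llim k V (i : V) : definable (fun _ _ v => llim k (v i)).
Proof.
elim: k V i => [|k IHk] V i /=; first exact: definable_true.
apply: definable_and.
  by apply: definable_exists; exact: definable_lt.
apply: definable_forall; apply: definable_imp; first exact: definable_lt.
apply: definable_exists; do 2?[apply: definable_and]; last exact: IHk.
- exact: definable_lt.
- exact: definable_lt.
Qed.

Lemma definable_rlim k V (i : V) : definable (fun _ _ v => rlim k (v i)).
Proof.
elim: k V i => [|k IHk] V i; first exact: definable_true.
apply: (definable_ext (fun d T v => iff_sym (rlimS k (v i)))).
apply: definable_and.
  by apply: definable_exists; exact: definable_lt.
apply: definable_forall; apply: definable_imp; first exact: definable_lt.
apply: definable_exists; do 2?[apply: definable_and]; last exact: IHk.
- exact: definable_lt.
- exact: definable_lt.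
Qed.

Lemma definable_has_succ V (i : V) : definable (fun _ _ v => has_succ (v i)).
Proof.
apply: definable_exists; apply: definable_and; first exact: definable_lt.
apply: definable_forall; apply: definable_imp; first exact: definable_lt.
exact: definable_le.
Qed.

Lemma definable_has_pred V (i : V) : definable (fun _ _ v => has_pred (v i)).
Proof.
apply: definable_exists; apply: definable_and; first exact: definable_lt.
apply: definable_forall; apply: definable_imp; first exact: definable_lt.
exact: definable_le.
Qed.

Lemma llim_le j k d (T : orderType d) (x : T) :
  (j <= k)%N -> llim k x -> llim j x.
Proof.
elim: k j x => [|k IHk] [|j] x //= jk [y0 H]; split=> // y /H[z [yz [zx zk]]].
by exists z; split=> //; split=> //; apply: IHk zk.
Qed.

Lemma rlim_le j k d (T : orderType d) (x : T) :
  (j <= k)%N -> rlim k x -> rlim j x.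
Proof. exact: llim_le. Qed.

Lemma has_pred_llim d (T : orderType d) (x : T) : has_pred x -> ~ llim 1 x.
Proof.
move=> [y [yx ymax]] [_ /(_ y yx)[z [yz [zx _]]]].
by have := ymax z zx; rewrite leNgt yz.
Qed.

Lemma has_succ_rlim d (T : orderType d) (x : T) : has_succ x -> ~ rlim 1 x.
Proof. exact: (@has_pred_llim _ T^d). Qed.

Lemma llim_has_pred d (T : orderType d) (x y : T) :
  y < x -> ~ llim 1 x -> has_pred x.
Proof.
move=> yx nl; apply: contrapT => np; apply: nl; split; first by exists y.
move=> z zx; apply: contrapT => H; apply: np; exists z; split=> // w wx.
by rewrite leNgt; apply/negP => zw; apply: H; exists w.
Qed.

Lemma rlim_has_succ d (T : orderType d) (x y : T) :
  x < y -> ~ rlim 1 x -> has_succ x.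
Proof. exact: (@llim_has_pred _ T^d). Qed.

(** The rank of [x] depends only on the points just below it, so a convex embedding preserves it.
    The point [y < x] keeps these points inside the image; a least point of [T'] may gain rank from
    what precedes the image. *)
Lemma llim_embed d d' (T' : orderType d') (T : orderType d) (e : T' -> T) k x y :
  {mono e : x y / x < y} ->
  (forall x y z, e x < z -> z < e y -> exists w, z = e w) ->
  y < x -> llim k x <-> llim k (e x).
Proof.
move=> emono econv.
elim: k x y => [|k IHk] x y yx //=; split=> [[_ H]|[_ H]].
- split=> [|z zx]; first by exists (e y); rewrite emono.
  have [zy|yz] := leP z (e y).
    have [w [yw [wx wk]]] := H _ yx.
    exists (e w); rewrite emono; split; first by rewrite (le_lt_trans zy) ?emono.
    by split=> //; exact/(IHk _ _ yw).
  have [w zE] := econv _ _ _ yz zx; subst z.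
  rewrite emono in zx.
  have [z [wz [zx' zk]]] := H _ zx.
  by exists (e z); rewrite !emono; split=> //; split=> //; exact/(IHk _ _ wz).
- split=> [|z zx]; first by exists y.
  have := H (e z); rewrite emono => /(_ zx)[w' [zw [wx wk]]].
  have [w wE] := econv _ _ _ zw wx; subst w'.
  rewrite !emono in zw wx.
  by exists w; split=> //; split=> //; exact/(IHk _ _ zw).
Qed.

(* The supremum of a set of limits is again a limit. *)
Lemma llim1_max d (T : orderType d) (I : T -> Prop) (y : T) :
  (forall P : T -> Prop, (exists x, I x /\ P x) ->
     exists x, [/\ I x, P x & forall y, I y -> P y -> x <= y]) ->
  (forall x y z, I x -> I z -> x <= y -> y <= z -> I y) ->
  I y -> (exists z, [/\ I z, z <= y & llim 1 z]) ->
  exists z, [/\ I z, z <= y, llim 1 z &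
    forall w, I w -> w <= y -> llim 1 w -> w <= z].
Proof.
move=> wfI convI Iy [z0 [Iz0 z0y z0l]].
have := wfI (fun u => forall w, I w -> w <= y -> llim 1 w -> w <= u).
case=> [|u [Iu uub umin]]; first by exists y.
have uy : u <= y by apply: umin.
have [lu|nlu] := EM (llim 1 u); first by exists u.
have lt_u z : I z -> z <= y -> llim 1 z -> z < u.
  move=> Iz zy zl; rewrite lt_neqAle uub // andbT.
  by apply/eqP => zu; apply: nlu; rewrite -zu.
(* If [u] is not itself a limit, all the limits in question lie strictly below it and, [u] being
   their least upper bound, come arbitrarily close to it. So [u] is a limit after all. *)
case: nlu; split; first by exists z0; apply: lt_u.
move=> w wu; have [z0w|wz0] := leP z0 w; last first.
  by exists z0; split=> //; split=> //; apply: lt_u.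
have Iw : I w by apply: (convI z0 w u) => //; apply: ltW.
apply: contrapT => H; suff : u <= w by rewrite leNgt wu.
apply: umin => // z Iz zy zl; rewrite leNgt; apply/negP => wz.
by apply: H; exists z; split=> //; split=> //; apply: lt_u.
Qed.

(** * Blocks *)

(** What the argument needs of a copy of $\omega^a$ inside [T]. The least point of [B] is exempt in
    [block_nlim] because its rank depends on what precedes [B]. For [a = 0] every point has rank 0,
    so [block_nlim] leaves at most one point. *)
Record block (a : nat) (d : Order.disp_t) (T : orderType d) (B : T -> Prop) :
    Prop := Block {
  block_wf : forall P : T -> Prop, (exists x, B x /\ P x) ->
    exists x, [/\ B x, P x & forall y, B y -> P y -> x <= y];
  block_cofinal : forall k x, (k < a)%N -> B x ->
    exists y, [/\ B y, x < y & llim k y];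
  block_nlim : forall x y, B x -> B y -> y < x -> ~ llim a x }.

Lemma block_embed a d d' (T' : orderType d') (T : orderType d) (e : T' -> T)
    (B : T -> Prop) :
  {mono e : x y / x < y} ->
  (forall x y z, e x < z -> z < e y -> exists w, z = e w) ->
  (forall x, B x <-> exists y, x = e y) ->
  block a (fun _ : T' => True) -> block a B.
Proof.
move=> emono econv eB [wf unb nlim]; split.
- move=> P [_ [/eB[x ->] Px]].
  have [|z [_ Pz zmin]] := wf (P \o e); first by exists x.
  exists (e z); split=> //; first by apply/eB; exists z.
  move=> _ /eB[y ->] Py; rewrite leNgt emono -leNgt.
  exact: zmin.
- move=> k _ ka /eB[x ->]; have [y [_ xy yl]] := unb k x ka I.
  exists (e y); rewrite emono; split=> //; first by apply/eB; exists y.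
  by exact/(llim_embed k emono econv xy).
- move=> _ _ /eB[x ->] /eB[y ->]; rewrite emono => yx.
  by move/(llim_embed a emono econv yx); apply: nlim yx.
Qed.

Inductive monomial := Omega of nat | OmegaRev of nat.

Definition monomial_block (c : monomial) (d : Order.disp_t) (T : orderType d)
    (B : T -> Prop) : Prop :=
  match c with
  | Omega a => block a B
  | OmegaRev a => @block a _ T^d B
  end.

(** The map [tg] abstracts the index of a term, so that the same lemmas serve ordered sums and also
    $\omega^{a+1}$, cut into copies of $\omega^a$ by the leading entry. *)
Record blocks (d : Order.disp_t) (T : orderType d) (tg : T -> nat)
    (c : nat -> monomial) : Prop := Blocks {
  tag_le : forall x y, x <= y -> (tg x <= tg y)%N;
  tag_surj : forall i, exists x, tg x = i;
  tag_block : forall i, monomial_block (c i) (fun x => tg x = i) }.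

Section Blocks.
Variables (d : Order.disp_t) (T : orderType d) (tg : T -> nat).
Variables (c : nat -> monomial) (hT : blocks tg c).
Implicit Types x y z : T.

Lemma tag_lt x y : (tg x < tg y)%N -> x < y.
Proof. by rewrite ltNge => ?; apply/negP => /(tag_le hT); rewrite leqNgt => /negP. Qed.

Lemma tag_wf i a : c i = Omega a -> forall P : T -> Prop,
  (exists x, tg x = i /\ P x) ->
  exists x, [/\ tg x = i, P x & forall y, tg y = i -> P y -> x <= y].
Proof. by move=> ci; have := tag_block hT i; rewrite ci => -[]. Qed.

Lemma tag_cofinal i a k x : c i = Omega a -> (k < a)%N -> tg x = i ->
  exists y, [/\ tg y = i, x < y & llim k y].
Proof. by move=> ci; have := tag_block hT i; rewrite ci => -[_ H _]; apply: H. Qed.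

Lemma tag_nlim i a x y : c i = Omega a -> tg x = i -> tg y = i -> y < x ->
  ~ llim a x.
Proof. by move=> ci; have := tag_block hT i; rewrite ci => -[_ _]; apply. Qed.

Lemma tag_cowf i a : c i = OmegaRev a -> forall P : T -> Prop,
  (exists x, tg x = i /\ P x) ->
  exists x, [/\ tg x = i, P x & forall y, tg y = i -> P y -> y <= x].
Proof. by move=> ci; have := tag_block hT i; rewrite ci => -[]. Qed.

Lemma tag_coinitial i a k x : c i = OmegaRev a -> (k < a)%N -> tg x = i ->
  exists y, [/\ tg y = i, y < x & rlim k y].
Proof. by move=> ci; have := tag_block hT i; rewrite ci => -[_ H _]; apply: H. Qed.

Lemma tag_nrlim i a x y : c i = OmegaRev a -> tg x = i -> tg y = i -> x < y ->
  ~ rlim a x.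
Proof. by move=> ci; have := tag_block hT i; rewrite ci => -[_ _]; apply. Qed.

Lemma tag_has_succ i a x : c i = Omega a -> (0 < a)%N -> tg x = i -> has_succ x.
Proof.
move=> ci a0 xi; have [y0 [y0i xy0 _]] := tag_cofinal ci a0 xi.
have [|y [yi xy ymin]] := tag_wf ci (P := fun y => x < y); first by exists y0.
exists y; split=> // z xz; have [zi|zi] := eqVneq (tg z) i; first exact: ymin.
apply/ltW/tag_lt; rewrite yi ltn_neqAle eq_sym zi -xi.
exact/(tag_le hT)/ltW.
Qed.

Lemma tag_has_pred i a x : c i = OmegaRev a -> (0 < a)%N -> tg x = i -> has_pred x.
Proof.
move=> ci a0 xi; have [y0 [y0i xy0 _]] := tag_coinitial ci a0 xi.
have [|y [yi xy ymin]] := tag_cowf ci (P := fun y => y < x); first by exists y0.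
exists y; split=> // z xz; have [zi|zi] := eqVneq (tg z) i; first exact: ymin.
apply/ltW/tag_lt; rewrite yi ltn_neqAle zi -xi.
exact/(tag_le hT)/ltW.
Qed.

Lemma tag_min i a : c i = Omega a ->
  exists x, tg x = i /\ forall y, (i <= tg y)%N -> x <= y.
Proof.
move=> ci; have [x0 x0i] := tag_surj hT i.
have [|x [xi _ xmin]] := tag_wf ci (P := fun=> True); first by exists x0.
exists x; split=> // y; rewrite leq_eqVlt => /predU1P[iy|iy]; first exact: xmin.
by apply/ltW/tag_lt; rewrite xi.
Qed.

Lemma tag_max i a : c i = OmegaRev a ->
  exists x, tg x = i /\ forall y, (tg y <= i)%N -> y <= x.
Proof.
move=> ci; have [x0 x0i] := tag_surj hT i.
have [|x [xi _ xmin]] := tag_cowf ci (P := fun=> True); first by exists x0.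
exists x; split=> // y; rewrite leq_eqVlt => /predU1P[iy|iy]; first exact: xmin.
by apply/ltW/tag_lt; rewrite xi.
Qed.

(** Limits of each rank below [a] are cofinal in $\omega^a$, and [x] is the first point above them
    all. *)
Lemma tag_min_llim i a x : c i = Omega a -> tg x = i.+1 ->
  (forall y, tg y = i.+1 -> x <= y) -> llim a x.
Proof.
move=> ci xi xmin; case: a ci => // a ci.
have [y0 y0i] := tag_surj hT i; split; first by exists y0; apply: tag_lt; rewrite y0i xi.
move=> y yx.
have yi : (tg y <= i)%N.
  rewrite -ltnS -xi ltn_neqAle (tag_le hT (ltW yx)) andbT.
  by apply/eqP => yxi; have := xmin y; rewrite leNgt yx yxi => /(_ xi).
have [y1 [y1i yy1]] : exists y1, tg y1 = i /\ y <= y1.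
  move: yi; rewrite leq_eqVlt => /predU1P[yi|yi]; first by exists y.
  by exists y0; split=> //; apply/ltW/tag_lt; rewrite y0i.
have [z [zi y1z zl]] := tag_cofinal ci (ltnSn a) y1i.
exists z; split; first exact: le_lt_trans y1z.
by split=> //; apply: tag_lt; rewrite zi xi.
Qed.

Lemma tag_max_rlim i a x : c i.+1 = OmegaRev a -> tg x = i ->
  (forall y, tg y = i -> y <= x) -> rlim a x.
Proof.
move=> ci xi xmax; case: a ci => // a ci; apply/rlimS.
have [y0 y0i] := tag_surj hT i.+1; split; first by exists y0; apply: tag_lt; rewrite y0i xi.
move=> y xy.
have yi : (i < tg y)%N.
  rewrite -xi ltn_neqAle (tag_le hT (ltW xy)) andbT.
  by apply/eqP => yxi; have := xmax y; rewrite leNgt xy -yxi => /(_ xi).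
have [y1 [y1i yy1]] : exists y1, tg y1 = i.+1 /\ y1 <= y.
  move: yi; rewrite leq_eqVlt => /predU1P[yi|yi]; first by exists y.
  by exists y0; split=> //; apply/ltW/tag_lt; rewrite y0i.
have [z [zi y1z zl]] := tag_coinitial ci (ltnSn a) y1i.
exists z; split; first exact: lt_le_trans yy1.
by split=> //; apply: tag_lt; rewrite zi xi.
Qed.

(** If the first point of a term had rank [a.+1], some limit of rank [a] in the preceding $\omega^a$
    would lie beyond [y]. It would not be the first point of that term, which [block_nlim]
    forbids. *)
Lemma tag_min_nllim i a x y : c i = Omega a -> tg x = i.+1 -> tg y = i ->
  ~ llim a.+1 x \/ exists z, tg z = i.+1 /\ z < x.
Proof.
move=> ci xi yi.
have [?|nz] := EM (exists z, tg z = i.+1 /\ z < x); [by right|left].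
have yx : y < x by apply: tag_lt; rewrite yi xi.
move=> [_ /(_ y yx)[z [yz [zx zl]]]].
suff zi : tg z = i by apply: tag_nlim ci zi yi yz zl.
apply/eqP; rewrite eqn_leq -{2}yi (tag_le hT (ltW yz)) andbT -ltnS.
rewrite -xi ltn_neqAle (tag_le hT (ltW zx)) andbT.
by apply/eqP => zi; apply: nz; exists z; rewrite zi xi.
Qed.

End Blocks.

(** The least points of the copies of $\omega^a$ supply the cofinal limits of rank [a]. A limit of
    rank [a.+1] would have to be the least point of its copy, but the preceding copy gives that
    point rank [a] only. *)
Lemma blocks_omegaS a d (T : orderType d) (tg : T -> nat) :
  blocks tg (fun=> Omega a) -> block a.+1 (fun _ : T => True).
Proof.
move=> hT; split.
- move=> P [x0 [_ Px0]].
  have ex : exists i, `[< exists x, tg x = i /\ P x >].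
    by exists (tg x0); apply/asboolP; exists x0.
  case: (ex_minnP ex) => i /asboolP Pi imin.
  have [x [xi Px xmin]] := tag_wf hT (erefl (Omega a)) Pi.
  exists x; split=> // y _ Py.
  have : (i <= tg y)%N by apply: imin; apply/asboolP; exists y.
  rewrite leq_eqVlt => /predU1P[iy|iy]; first exact: xmin.
  by apply/ltW/(tag_lt hT); rewrite xi.
- move=> k x ka _.
  have [y [yi ymin]] := tag_min hT (i := (tg x).+1) (erefl (Omega a)).
  exists y; split=> //; first by apply: (tag_lt hT); rewrite yi.
  apply: (@llim_le _ a) => //.
  apply: (tag_min_llim hT (erefl (Omega a)) yi) => z zi.
  by apply: ymin; rewrite zi.
- move=> x y _ _ yx lx.
  have nmin z : tg z = tg x -> ~ z < x.
    move=> zx /(tag_nlim hT (erefl (Omega a)) erefl zx); apply.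
    exact: llim_le lx.
  case E: (tg x) => [|i].
    apply: (nmin y) => //; apply/eqP; rewrite eqn_leq (tag_le hT (ltW yx)).
    by rewrite E.
  have [w wi] := tag_surj hT i.
  by have [|[z [zi]]] := tag_min_nllim hT (erefl (Omega a)) E wi => //; apply: nmin; rewrite zi.
Qed.

(** * Powers of omega *)

Lemma order_iso_sym d d' (T : orderType d) (T' : orderType d') :
  order_iso T T' -> order_iso T' T.
Proof.
move=> [f [[g gK fK] fmono]]; exists g; split; first by exists f.
by move=> x y; rewrite -fmono !fK.
Qed.

Lemma order_iso_trans d1 d2 d3 (T1 : orderType d1) (T2 : orderType d2)
    (T3 : orderType d3) :
  order_iso T1 T2 -> order_iso T2 T3 -> order_iso T1 T3.
Proof.
move=> [f [fbij fmono]] [g [gbij gmono]]; exists (g \o f).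
by split=> [|x y /=]; [exact: bij_comp|rewrite gmono fmono].
Qed.

Lemma order_iso_dual d d' (T : orderType d) (T' : orderType d') :
  order_iso T T' -> order_iso T^d T'^d.
Proof. by move=> [f [fbij fmono]]; exists f; split=> // x y; apply: fmono. Qed.

Lemma order_iso_surj d d' (T : orderType d) (T' : orderType d') (f : T -> T') :
  {mono f : x y / x < y} -> (forall z, exists x, z = f x) -> order_iso T T'.
Proof.
move=> fmono /choice[g gP].
have finj : injective f.
  by move=> x y fxy; case: (ltgtP x y) => //; rewrite -fmono fxy ltxx.
exists f; split; last by move=> x y; rewrite !leNgt fmono.
by exists g => x; [apply: finj; rewrite -gP|rewrite -gP].
Qed.

Lemma order_iso_osum2 d d' (M N : orderType d) (K : orderType d')
    (f : M -> K) (g : N -> K) :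
  {mono f : x y / x < y} -> {mono g : x y / x < y} ->
  (forall x y, f x < g y) ->
  (forall z, (exists x, z = f x) \/ (exists y, z = g y)) ->
  order_iso (osum2 M N) K.
Proof.
move=> fmono gmono fg fgsurj.
pose h (p : osum2 M N) : K :=
  (if tag p as b return (if b then N else M) -> K then g else f) (tagged p).
apply: (@order_iso_surj _ _ _ _ h).
  move=> [[] x] [[] y]; rewrite ltEsig /h /= ?tagged_asE //=.
  - by apply/negbTE; rewrite -leNgt; apply/ltW/fg.
  - exact: fg.
move=> z; have [[x ->]|[y ->]] := fgsurj z.
- by exists (existT (fun b : bool => if b then N else M) false x).
- by exists (existT (fun b : bool => if b then N else M) true y).
Qed.

Definition omega_cons a (n : nat) (s : omega_pow a) : omega_pow a.+1 :=
  [tuple of n :: s].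

Lemma lt_omega_cons a n m (s r : omega_pow a) :
  (omega_cons n s < omega_cons m r) = (n < m)%N || (n == m) && (s < r).
Proof.
rewrite [LHS]ltxi_cons !leEnat.
by case: (ltngtP n m) => //= _; rewrite ?implybT.
Qed.

Lemma omega_consP a (z : omega_pow a.+1) : exists n s, z = omega_cons n s.
Proof. by exists (thead z), [tuple of behead z]; apply: tuple_eta. Qed.

Lemma block_omega_pow a : block a (fun _ : omega_pow a => True).
Proof.
elim: a => [|a IHa].
  split=> // [P [x [_ Px]]|x y _ _].
    by exists x; split=> // y _ _; rewrite (tuple0 x) (tuple0 y).
  by rewrite (tuple0 x) (tuple0 y) ltxx.
apply: (@blocks_omegaS _ _ _ (fun z : omega_pow a.+1 => thead z)).
split.
- move=> x y; have [n [s ->]] := omega_consP x; have [m [r ->]] := omega_consP y.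
  rewrite leNgt lt_omega_cons !theadE.
  by case: (ltnP m n).
- by move=> i; exists (omega_cons i [tuple of nseq a 0]); rewrite theadE.
- move=> i; apply: (block_embed (e := omega_cons i) _ _ _ IHa).
  + by move=> x y; rewrite lt_omega_cons ltnn eqxx.
  + move=> x y z; have [n [s ->]] := omega_consP z.
    rewrite !lt_omega_cons => /orP[iz|/andP[/eqP <- _] _]; last by exists s.
    move=> /orP[zi|/andP[/eqP <- _]]; last by exists s.
    by have := ltn_trans iz zi; rewrite ltnn.
  + move=> x; have [n [s ->]] := omega_consP x; rewrite theadE.
    split=> [->|[r]]; first by exists s.
    by move/(congr1 val) => -[].
Qed.

(** From the point with leading entry [n] and remainder [s] on, there remain a final segment of copy
    [n], which is a full copy by induction, and all later copies. Shifting the leading entry by [n]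
    matches these with the copies from 0 on. *)
Lemma omega_pow_final a (y : omega_pow a) : exists f : omega_pow a -> omega_pow a,
  {mono f : x y / x < y} /\ forall z, y <= z <-> exists w, z = f w.
Proof.
elim: a y => [|a IHa] y.
  exists id; split=> // z; split=> [_|_]; first by exists z.
  by rewrite (tuple0 y) (tuple0 z).
have [n [s ->]] := omega_consP y.
have [f [fmono fP]] := IHa s.
pose g (z : omega_pow a.+1) : omega_pow a.+1 :=
  let t : omega_pow a := [tuple of behead z] in
  omega_cons (n + thead z) (if thead z == 0%N then f t else t).
have gE m r : g (omega_cons m r) = omega_cons (n + m) (if m == 0%N then f r else r).
  rewrite /g theadE; congr omega_cons.
  by have -> : [tuple of behead (omega_cons m r)] = r by apply: val_inj.
exists g; split.
  move=> x y'; have [k [r ->]] := omega_consP x; have [m [t ->]] := omega_consP y'.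
  rewrite !gE !lt_omega_cons ltn_add2l eqn_add2l.
  by case: eqP => // <-; case: eqP; rewrite ?fmono.
move=> z; have [m [t ->]] := omega_consP z.
rewrite leNgt lt_omega_cons negb_or -leqNgt negb_and -leNgt.
split=> [/andP[nm nt]|[w]].
  have [mn|mn] := eqVneq m n.
    have /fP[w tw] : s <= t by move: nt; rewrite mn eqxx.
    by exists (omega_cons 0 w); rewrite gE addn0 tw mn.
  exists (omega_cons (m - n) t); rewrite gE subnKC // ifN //.
  by rewrite subn_eq0 -ltnNge ltn_neqAle eq_sym mn.
have [k [r ->]] := omega_consP w; rewrite gE => /(congr1 val)[-> tE].
rewrite leq_addr -{2}[n]addn0 eqn_add2l.
case: eqP tE => //= _ tE; apply/fP; exists r; exact: val_inj.
Qed.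

Lemma omega_pow_initial a b : (a < b)%N ->
  exists (y : omega_pow b) (g : omega_pow a -> omega_pow b),
    {mono g : x y / x < y} /\ forall z, z < y <-> exists w, z = g w.
Proof.
elim: b => // b IHb; rewrite ltnS leq_eqVlt => /predU1P[->|/IHb[y [g [gmono gP]]]].
  have [y0 [_ _ y0min]] := block_wf (block_omega_pow b)
    (ex_intro (fun x : omega_pow b => True /\ True) [tuple of nseq b 0] (conj I I)).
  (* $\omega^b$ is the first copy in $\omega^{b+1}$; it ends just before the point with leading
     entry 1 and least remainder. *)
  exists (omega_cons 1 y0), (omega_cons 0); split.
    by move=> x y; rewrite lt_omega_cons ltnn eqxx.
  move=> z; have [m [t ->]] := omega_consP z; rewrite lt_omega_cons ltnS leqn0.
  have -> : (t < y0) = false by apply/negbTE; rewrite -leNgt y0min.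
  rewrite andbF orbF; split=> [/eqP ->|[w /(congr1 val)[->]]] //.
  by exists t.
exists (omega_cons 0 y), (omega_cons 0 \o g); split.
  by move=> x y' /=; rewrite lt_omega_cons ltnn eqxx gmono.
move=> z; have [m [t ->]] := omega_consP z; rewrite lt_omega_cons ltn0 /=.
split=> [/andP[/eqP -> /gP[w ->]]|[w /(congr1 val)[-> tE]]]; first by exists w.
by rewrite eqxx /=; apply/gP; exists w; apply: val_inj.
Qed.

(** Cut $\omega^b$ at a point [y] below which there lies exactly a copy of $\omega^a$; the part from
    [y] on is again $\omega^b$. *)
Lemma omega_pow_absorb a b d (T T' : orderType d) : (a < b)%N ->
  order_iso T (omega_pow a) -> order_iso T' (omega_pow b) ->
  order_iso (osum2 T T') T'.
Proof.
move=> ab [e [ebij emono]] T'b; apply: order_iso_trans (order_iso_sym T'b).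
have [y [g [gmono gP]]] := omega_pow_initial ab.
have [f [fmono fP]] := omega_pow_final y.
have [e' [e'bij e'mono]] := T'b.
apply: (@order_iso_osum2 _ _ _ _ _ (g \o e) (f \o e')).
- by move=> x z /=; rewrite gmono (leW_mono emono).
- by move=> x z /=; rewrite fmono (leW_mono e'mono).
- move=> x z /=; apply: (@lt_le_trans _ _ y).
    by apply/gP; exists (e x).
  by apply/fP; exists (e' z).
move=> z; have [yz|zy] := leP y z; [right|left].
- by have /fP[w ->] := yz; have [h _ hK] := e'bij; exists (h w); rewrite /= hK.
- by have /gP[w ->] := zy; have [h _ hK] := ebij; exists (h w); rewrite /= hK.
Qed.

Lemma omega_pow_rev_absorb a b d (T T' : orderType d) : (a < b)%N ->
  order_iso T (omega_pow_rev a) -> order_iso T' (omega_pow_rev b) ->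
  order_iso (osum2 T' T) T'.
Proof.
move=> ab [e [ebij emono]] T'b; apply: order_iso_trans (order_iso_sym T'b).
have [y [g [gmono gP]]] := omega_pow_initial ab.
have [f [fmono fP]] := omega_pow_final y.
have [e' [e'bij e'mono]] := T'b.
apply: (@order_iso_osum2 _ _ _ _ (omega_pow_rev b) (f \o e') (g \o e)).
- by move=> x z; rewrite -(leW_mono e'mono); apply: fmono.
- by move=> x z; rewrite -(leW_mono emono); apply: gmono.
- move=> x z; apply: (@lt_le_trans _ (omega_pow b) y).
    by apply/gP; exists (e z).
  by apply/fP; exists (e' x).
move=> z; have [yz|zy] := leP (y : omega_pow b) z; [left|right].
- by have /fP[w ->] := yz; have [h _ hK] := e'bij; exists (h w); rewrite /= hK.
- by have /gP[w ->] := zy; have [h _ hK] := ebij; exists (h w); rewrite /= hK.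
Qed.

Lemma omega_pow1 : order_iso (omega_pow 1) nat.
Proof.
apply: (@order_iso_surj _ _ _ _ (fun s : omega_pow 1 => thead s)).
  move=> x y; have [n [s ->]] := omega_consP x; have [m [r ->]] := omega_consP y.
  by rewrite lt_omega_cons !theadE (tuple0 s) (tuple0 r) ltxx andbF orbF.
by move=> n; exists (omega_cons n [tuple]); rewrite theadE.
Qed.

Lemma omega_pow_rev1 : order_iso (omega_pow_rev 1) nat^d.
Proof. exact: order_iso_dual omega_pow1. Qed.

Lemma omega_pow_rev0 : order_iso (omega_pow_rev 0) (omega_pow 0).
Proof.
by exists id; split=> [|x y]; [exists id|rewrite (tuple0 x) (tuple0 y) !lexx].
Qed.

(** * Definable initial segments of special monomial sums *)

(** The first three fields express that no term absorbs a neighbour, the last two that the sum is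
    special. By [code_rev] a one-point term is always coded [Omega 0], never as a reversed power. *)
Record special_code (c : nat -> monomial) : Prop := SpecialCode {
  code_desc : forall i a b, c i = Omega a -> c i.+1 = Omega b -> (b <= a)%N;
  code_asc : forall i a b, c i = OmegaRev a -> c i.+1 = OmegaRev b -> (a <= b)%N;
  code_turn : forall i a b, c i = OmegaRev a -> c i.+1 = Omega b -> (0 < b)%N;
  code_rev : forall i a, c i = OmegaRev a -> (0 < a)%N;
  code_special : forall i m, (0 < m)%N ->
    c i = Omega 1 -> c i.+1 = OmegaRev 1 -> c i.+2 <> Omega m;
  code_special_rev : forall i m, (0 < m)%N ->
    c i = OmegaRev m -> c i.+1 = Omega 1 -> c i.+2 <> OmegaRev 1 }.

Definition is_omega (c : monomial) := if c is Omega _ then true else false.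

Lemma is_omegaP (c : monomial) : is_omega c -> exists a, c = Omega a.
Proof. by case: c => // a _; exists a. Qed.

(** Holds along a leading run of powers of $\omega$ and fails after a turn to a reversed power,
    except that a turn from $\omega$ to $\omega^*$ is not noticed at once. The second clause detects
    a gap at which limits accumulate, the first clause the other turns. *)
Definition good (d : Order.disp_t) (T : orderType d) (x : T) : Prop :=
  (forall y, y < x -> has_succ y) /\
  (forall y, y <= x -> (exists z, z <= y /\ llim 1 z) ->
    exists z, z <= y /\ llim 1 z /\ forall w, w <= y -> llim 1 w -> w <= z).

(* In a sum starting with omega^a, [low a] defines the first term, except that
   if that is omega followed by its reverse, both terms. *)
Definition low (a : nat) (d : Order.disp_t) (T : orderType d) (x : T) : Prop :=
  good x /\ forall y, y <= x -> ~ llim a y.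

(** Among sums starting with a power of positive exponent, this holds for first term $\omega^{a+1}$
    unless the sum starts with $\omega + \omega^*$, and it forces the exponent to exceed [a]. Used
    in both directions it pins the exponent down. *)
Definition omega_start (a : nat) (d : Order.disp_t) (T : orderType d) : Prop :=
  (exists x : T, ~ low a.+1 x) /\
  (forall x : T, low a.+1 x -> exists y, x < y /\ low a.+1 y /\ llim a y).

(* In a sum starting with the reverse of omega^a, [colow a] defines the first term if it
   is followed by a reversed power, and otherwise the first term together with
   a part of the second one. *)
Definition colow (a : nat) (d : Order.disp_t) (T : orderType d) (x : T) : Prop :=
  (forall y, y <= x -> has_pred y) /\
  (forall y, y < x -> ~ rlim a y) /\
  (forall y, y < x -> (exists z, y <= z /\ z < x /\ rlim 1 z) ->
    exists z, y <= z /\ z < x /\ rlim 1 z /\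
      forall w, y <= w -> w < x -> rlim 1 w -> z <= w).

Ltac definability :=
  repeat match goal with
  | |- definable _ =>
    first [ exact: definable_lt | exact: definable_le | exact: definable_llim
          | exact: definable_rlim | exact: definable_has_succ
          | exact: definable_has_pred | apply: definable_and
          | apply: definable_not | apply: definable_imp
          | apply: definable_forall | apply: definable_exists ]
  end.

Lemma definable_good V (i : V) : definable (fun _ _ v => good (v i)).
Proof. rewrite /good; definability. Qed.

Lemma definable_low a V (i : V) : definable (fun _ _ v => low a (v i)).
Proof. apply: definable_and; [exact: definable_good|definability]. Qed.

Lemma definable_omega_start a : definable (V := void)
  (fun _ T _ => omega_start a T).
Proof.
apply: definable_and.
  by apply: definable_exists; apply: definable_not; apply: definable_low.
apply: definable_forall; apply: definable_imp; first exact: definable_low.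
apply: definable_exists; apply: definable_and; first exact: definable_lt.
by apply: definable_and; [exact: definable_low|exact: definable_llim].
Qed.

Lemma definable_colow a V (i : V) : definable (fun _ _ v => colow a (v i)).
Proof. rewrite /colow; definability. Qed.

(** * Extent of the definable segments in a coded sum *)

Section Codes.
Variables (d : Order.disp_t) (T : orderType d) (tg : T -> nat).
Variables (c : nat -> monomial) (hT : blocks tg c) (hc : special_code c).
Implicit Types x y z : T.

(** The terms up to that of [x] form a well-order, so [llim1_max] provides greatest limits. A point
    has its successor in its own term or, if that term is a single point, as the least point of the
    next. *)
Lemma good_run x : (forall i, (i <= tg x)%N -> is_omega (c i)) -> good x.
Proof.
move=> run; split=> [y yx|y yx [z [zy zl]]].
  have [a ca] := is_omegaP (run _ (tag_le hT (ltW yx))).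
  have [a0|a0] := posnP a; last exact: (tag_has_succ hT ca a0 erefl).
  rewrite a0 in ca.
  have yxi : (tg y < tg x)%N.
    rewrite ltn_neqAle (tag_le hT (ltW yx)) andbT; apply/eqP => xy.
    by apply: (tag_nlim hT ca _ _ yx).
  have [b cb] := is_omegaP (run _ yxi).
  have [w [wi wmin]] := tag_min hT cb.
  exists w; split=> [|z yz]; first by apply: (tag_lt hT); rewrite wi.
  apply: wmin; rewrite ltn_neqAle (tag_le hT (ltW yz)) andbT.
  by apply/eqP => yzi; apply: (tag_nlim hT ca _ _ yz).
have := @llim1_max _ T (fun u => (tg u <= tg x)%N) y; case.
- move=> P [x0 [x0x Px0]].
  have ex : exists i, `[< exists x, tg x = i /\ P x >].
    by exists (tg x0); apply/asboolP; exists x0.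
  case: (ex_minnP ex) => i /asboolP Pi imin.
  have ix : (i <= tg x)%N.
    by apply: leq_trans x0x; apply: imin; apply/asboolP; exists x0.
  have [a ca] := is_omegaP (run _ ix).
  have [u [ui Pu umin]] := tag_wf hT ca Pi.
  exists u; split=> //; first by rewrite ui.
  move=> w _ Pw; have : (i <= tg w)%N by apply: imin; apply/asboolP; exists w.
  rewrite leq_eqVlt => /predU1P[iw|iw]; first exact: umin.
  by apply/ltW/(tag_lt hT); rewrite ui.
- by move=> u v w _ wx _ vw; apply: leq_trans wx; apply: (tag_le hT).
- exact: (tag_le hT).
- exists z; split=> //; apply: (tag_le hT); exact: le_trans yx.
move=> u [_ uy ul umax]; exists u; split=> //; split=> // w wy.
by apply: umax => //; apply: (tag_le hT); apply: le_trans yx.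
Qed.

(** For [e = 0] the single point of term [j] has no successor, since the next term has no least
    point. For [e = 1] we have [f > 1], and limits from the right, which have no successor, are
    coinitial in the reversed power. For [e > 1] limits are cofinal in $\omega^e$ but absent from
    the reversed power, so none is greatest. *)
Lemma good_stop j e f y : c j = Omega e -> c j.+1 = OmegaRev f ->
  ~ (e = 1 /\ f = 1)%N -> (j < tg y)%N -> ~ good y.
Proof.
move=> cj cj1 ef jy [succ lmax].
have f0 := code_rev hc cj1.
have [x [xj xy]] : exists x, tg x = j.+1 /\ x <= y.
  move: jy; rewrite leq_eqVlt => /predU1P[jy|jy]; first by exists y.
  have [x xj] := tag_surj hT j.+1.
  by exists x; split=> //; apply/ltW/(tag_lt hT); rewrite xj.
have [y0 [y0j y0min]] := tag_min hT cj.
case: e cj ef => [|[|e]] cj ef.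
- have [|u [yu umin]] := succ y0; first by apply: (tag_lt hT); rewrite y0j.
  have [uj|uj] := eqVneq (tg u) j; first by apply: (tag_nlim hT cj uj y0j yu).
  have {}uj : (j < tg u)%N by rewrite ltn_neqAle eq_sym uj -y0j (tag_le hT (ltW yu)).
  have ux : u <= x by apply: umin; apply: (tag_lt hT); rewrite xj y0j.
  have uj1 : tg u = j.+1 by apply/eqP; rewrite eqn_leq uj -xj (tag_le hT ux).
  have [w [wj wu _]] := tag_coinitial hT cj1 f0 uj1.
  suff : u <= w by rewrite leNgt wu.
  by apply: umin; apply: (tag_lt hT); rewrite wj y0j.
- have f1 : (1 < f)%N by case: f f0 ef cj1 => [|[|]] // _ [].
  have [w [wj wx wl]] := tag_coinitial hT cj1 f1 xj.
  by apply: has_succ_rlim wl; apply: succ; apply: lt_le_trans wx xy.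
- have [|u [ux [ul umax]]] := lmax x xy.
    have [w [wj _ wl]] := tag_cofinal hT cj (isT : (1 < e.+2)%N) y0j.
    by exists w; split=> //; apply/ltW/(tag_lt hT); rewrite wj xj.
  have uj : (tg u <= j)%N.
    have := tag_le hT ux; rewrite xj leq_eqVlt => /predU1P[uj|//].
    by case: (has_pred_llim (tag_has_pred hT cj1 f0 uj) ul).
  have {}uj : tg u = j.
    apply/eqP; rewrite eqn_leq uj.
    have [w [wj _ wl]] := tag_cofinal hT cj (isT : (1 < e.+2)%N) y0j.
    rewrite -wj; apply: (tag_le hT); apply: umax => //.
    by apply/ltW/(tag_lt hT); rewrite wj xj.
  have [w [wj uw wl]] := tag_cofinal hT cj (isT : (1 < e.+2)%N) uj.
  have : w <= u by apply: umax => //; apply/ltW/(tag_lt hT); rewrite wj xj.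
  by rewrite leNgt uw.
Qed.

Lemma tag_max_nsucc j f x : c j.+1 = OmegaRev f -> tg x = j ->
  (forall y, tg y = j -> y <= x) -> ~ has_succ x.
Proof.
move=> cj xj xmax; apply: contraPnot (tag_max_rlim hT cj xj xmax).
by move=> xs xl; apply: (has_succ_rlim xs); apply: rlim_le xl; exact: (code_rev hc cj).
Qed.

(** By specialness the third term is a reversed power, so the last point of $\omega^*$ has no
    successor. *)
Lemma good_stop_omega j y : c j = Omega 1 -> c j.+1 = OmegaRev 1 ->
  (j.+1 < tg y)%N -> ~ good y.
Proof.
move=> cj cj1 jy [succ _].
case cj2: (c j.+2) => [m|m].
  have m0 := code_turn hc cj1 cj2.
  exact: (code_special hc m0 cj cj1).
have [x [xj xmax]] := tag_max hT cj1.
have xy : x < y by apply: (tag_lt hT); rewrite xj.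
apply: (tag_max_nsucc cj2 xj) (succ _ xy) => z zj.
by apply: xmax; rewrite zj.
Qed.

(** Standing first, $\omega + \omega^*$ contains no limits from the left, which makes the second
    clause of [good] vacuous. *)
Lemma good_omega_rev x : c 0 = Omega 1 -> c 1 = OmegaRev 1 ->
  (tg x <= 1)%N -> good x /\ ~ llim 1 x.
Proof.
move=> c0 c1 x1.
have nl y : (tg y <= 1)%N -> ~ llim 1 y.
  rewrite leq_eqVlt ltnS leqn0 => /orP[] /eqP yi.
    exact: (has_pred_llim (tag_has_pred hT c1 isT yi)).
  move=> yl; have [[z zy] _] := yl; apply: (tag_nlim hT c0 yi _ zy) yl.
  by apply/eqP; rewrite -leqn0 -yi (tag_le hT (ltW zy)).
split; last exact: nl.
split=> [y yx|y yx [z [zy zl]]].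
  have := leq_trans (tag_le hT (ltW yx)) x1.
  rewrite leq_eqVlt ltnS leqn0 => /orP[] /eqP yi.
    have xi : tg x = 1%N by apply/eqP; rewrite eqn_leq x1 -yi (tag_le hT (ltW yx)).
    exact: rlim_has_succ yx (tag_nrlim hT c1 yi xi yx).
  exact: (tag_has_succ hT c0 isT yi).
case: (nl z) => //; apply: leq_trans x1; apply: (tag_le hT).
exact: le_trans yx.
Qed.

Lemma run_le b i : c 0 = Omega b -> (forall j, (j <= i)%N -> is_omega (c j)) ->
  exists a, c i = Omega a /\ (a <= b)%N.
Proof.
move=> c0; elim: i => [|i IHi] run; first by exists b.
have [|a [ca ab]] := IHi; first by move=> j ji; apply/run/leqW.
have [a' ca'] := is_omegaP (run _ (leqnn i.+1)).
by exists a'; split=> //; apply: leq_trans ab; exact: (code_desc hc ca ca').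
Qed.

(** Exponents do not increase along the run. A point other than the first of its term has rank below
    the exponent of that term, and a first point has at most the exponent of the preceding term as
    its rank. *)
Lemma run_nllim b a x : c 0 = Omega b -> (b < a)%N ->
  (forall j, (j <= tg x)%N -> is_omega (c j)) -> ~ llim a x.
Proof.
move=> c0 ba run xl.
have [e [ce eb]] := run_le c0 run.
have nmin y : tg y = tg x -> ~ y < x.
  move=> yx /(tag_nlim hT ce erefl yx); apply; apply: llim_le xl.
  exact: leq_trans eb (ltnW ba).
case E: (tg x) => [|i].
  case: a ba xl => // a _ [[y yx] _]; apply: (nmin y) => //.
  by apply/eqP; rewrite eqn_leq (tag_le hT (ltW yx)) E.
have [|e' [ce' eb']] := @run_le b i c0.
  by move=> j ji; apply: run; rewrite E ltnW.
have [w wi] := tag_surj hT i.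
have [|[z [zi zx]]] := tag_min_nllim hT ce' E wi.
  by apply; apply: llim_le xl; apply: leq_trans ba.
by apply: nmin zx; rewrite zi.
Qed.

Lemma run_low b a x : c 0 = Omega b -> (b < a)%N ->
  (forall j, (j <= tg x)%N -> is_omega (c j)) -> low a x.
Proof.
move=> c0 ba run; split; first exact: good_run.
move=> y yx; apply: (run_nllim c0 ba) => j jy.
exact/run/(leq_trans jy)/(tag_le hT).
Qed.

(** Beyond the first term, [good] fails if the second term is a reversed power; if it is a power,
    its least point is a limit of rank [a]. *)
Lemma low_tag a x : c 0 = Omega a -> (0 < a)%N ->
  ~ (a = 1%N /\ c 1 = OmegaRev 1) -> low a x <-> (tg x <= 0)%N.
Proof.
move=> c0 a0 nexc; split=> [[xg nl]|].
  rewrite leqNgt; apply/negP => x0; case c1: (c 1%N) => [b|b]; last first.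
    by apply: (good_stop c0 c1 _ x0 xg) => -[a1 b1]; apply: nexc; rewrite c1 b1.
  have [y [y1 ymin]] := tag_min hT c1.
  apply: (nl y); first exact: ymin.
  by apply: (tag_min_llim hT c0 y1) => z z1; apply: ymin; rewrite z1.
rewrite leqn0 => /eqP x0; split.
  by apply: good_run => i; rewrite x0 leqn0 => /eqP ->; rewrite c0.
move=> y yx yl.
have y0 z : z <= x -> tg z = 0%N.
  by move=> zx; apply/eqP; rewrite -leqn0 -x0 (tag_le hT zx).
case: a c0 a0 nexc yl => // a c0 _ _ yl; have [[z zy] _] := yl.
by apply: (tag_nlim hT c0 (y0 _ yx) (y0 _ _) zy yl); apply/ltW/(lt_le_trans zy).
Qed.

Lemma low_tag_exceptional x : c 0 = Omega 1 -> c 1 = OmegaRev 1 ->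
  low 1 x <-> (tg x <= 1)%N.
Proof.
move=> c0 c1; split=> [[xg _]|x1].
  by rewrite leqNgt; apply/negP => x1; apply: (good_stop_omega c0 c1 x1 xg).
split=> [|y yx]; first by have [] := good_omega_rev c0 c1 x1.
by have [] := good_omega_rev c0 c1 (leq_trans (tag_le hT yx) x1).
Qed.

Lemma omega_not_low1 a : c 0 = Omega a -> (0 < a)%N -> exists x, ~ low 1 x.
Proof.
move=> c0 a0; have [x0 x00] := tag_surj hT 0.
have [a1|a1] := leqP a 1; last first.
  have [x [_ _ xl]] := tag_cofinal hT c0 a1 x00.
  by exists x => -[_ /(_ x (lexx x))].
have {a1 a0} a1 : a = 1%N by apply/eqP; rewrite eqn_leq a1.
rewrite {}a1 in c0.
have [c1|c1] := EM (c 1 = OmegaRev 1).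
  have [x x2] := tag_surj hT 2.
  by exists x; rewrite (low_tag_exceptional _ c0 c1) x2.
have [x x1] := tag_surj hT 1.
by exists x; rewrite (low_tag _ c0) ?x1 // => -[_ /c1].
Qed.

Lemma omega_start_holds a : c 0 = Omega a.+1 ->
  ~ (a = 0 /\ c 1 = OmegaRev 1)%N -> omega_start a T.
Proof.
move=> c0 nexc.
have lowP x : low a.+1 x <-> (tg x <= 0)%N.
  by apply: low_tag => // -[[a0] c1]; apply: nexc.
split.
  by have [x x1] := tag_surj hT 1; exists x; rewrite lowP x1.
move=> x /lowP; rewrite leqn0 => /eqP x0.
have [y [y0 xy yl]] := tag_cofinal hT c0 (ltnSn a) x0.
by exists y; rewrite lowP y0.
Qed.

(** In the case $\omega + \omega^*$ nothing after the last point of $\omega^*$ is good. If [b <= a],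
    then [low a.+1] persists along the leading run of powers. An endless run leaves no point outside
    it; in a finite run, no limit of rank [a] in it follows the first point of the last power. *)
Lemma omega_start_ge a b : c 0 = Omega b -> (0 < b)%N -> omega_start a T ->
  ~ (b = 1%N /\ c 1 = OmegaRev 1) /\ (a < b)%N.
Proof.
move=> c0 b0 [[x0 x0low] start]; split=> [[b1 c1]|].
  rewrite {}b1 in c0; have [x [x1 xmax]] := tag_max hT c1.
  have nl y : y <= x -> ~ llim a.+1 y.
    move=> yx; have [|_ nl] := @good_omega_rev y c0 c1; last first.
      by apply: contra_not nl; apply: llim_le.
    by rewrite -x1; apply: (tag_le hT).
  have [|y [xy [[yg _] _]]] := start x.
    by split=> //; have [|] := @good_omega_rev x c0 c1; rewrite ?x1.
  apply: (good_stop_omega c0 c1 _ yg); rewrite ltnNge; apply/negP => y1.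
  by have := xmax y y1; rewrite leNgt xy.
rewrite ltnNge; apply/negP => ba.
have [allO|] := EM (forall i, is_omega (c i)).
  by apply: x0low; apply: (run_low c0 (ba : (b < a.+1)%N)).
move=> /existsNP[i0 /negP i0P].
have ex : exists i, ~~ is_omega (c i) by exists i0.
case: (ex_minnP ex) => -[|j] jP jmin; first by rewrite c0 in jP.
have run i : (i <= j)%N -> is_omega (c i).
  by move=> ij; apply/negPn/negP => /jmin; rewrite leqNgt ltnS ij.
case cj1: (c j.+1) jP => [//|f] _.
have f0 := code_rev hc cj1.
have [e [cj eb]] := run_le c0 run.
have [x [xj xmin]] := tag_min hT cj.
have [|y [xy [[yg _] yl]]] := start x.
  by apply: (run_low c0 (ba : (b < a.+1)%N)) => i; rewrite xj; apply: run.
(* Either [y] is in term [j] but not its first point, or it is in the reversed power, where all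
   points have predecessors, or it lies beyond, where [good] fails. *)
have jy : (j <= tg y)%N by rewrite -xj (tag_le hT (ltW xy)).
have a0 : (0 < a)%N by apply: leq_trans ba.
move: jy; rewrite leq_eqVlt => /predU1P[jy|].
  apply: (tag_nlim hT cj (esym jy) xj xy); apply: llim_le yl.
  exact: leq_trans eb ba.
rewrite leq_eqVlt => /predU1P[jy|jy].
  apply: (has_pred_llim (tag_has_pred hT cj1 f0 (esym jy))).
  exact: llim_le yl.
have [[e1 f1]|ef] := EM (e = 1 /\ f = 1)%N.
  by rewrite e1 f1 in cj cj1; apply: (good_stop_omega cj cj1 jy yg).
by apply: (good_stop cj cj1 ef _ yg); apply: ltnW.
Qed.

Lemma omega_has_min a : c 0 = Omega a -> exists x : T, forall y, x <= y.
Proof. by move=> /(tag_min hT)[x [_ xmin]]; exists x => y; apply: xmin. Qed.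

Lemma omega_rev_no_min a : c 0 = OmegaRev a -> ~ exists x : T, forall y, x <= y.
Proof.
move=> c0 [x xmin]; have [y y0] := tag_surj hT 0.
have x0 : tg x = 0%N by apply/eqP; rewrite -leqn0 -y0 (tag_le hT (xmin y)).
have [z [_ zx _]] := tag_coinitial hT c0 (code_rev hc c0) x0.
by have := xmin z; rewrite leNgt zx.
Qed.

Lemma omega_rev_rlim a b : c 0 = OmegaRev b ->
  (forall x : T, exists y, y < x /\ rlim a y) <-> (a < b)%N.
Proof.
move=> c0; have [x0 x00] := tag_surj hT 0; split=> [H|ab x].
  rewrite ltnNge; apply/negP => ba; have [y [yx yl]] := H x0.
  apply: (tag_nrlim hT c0 _ x00 yx); last exact: rlim_le ba yl.
  by apply/eqP; rewrite -leqn0 -x00 (tag_le hT (ltW yx)).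
have [y [y0 yx]] : exists y, tg y = 0%N /\ y <= x.
  have [x0'|x0'] := posnP (tg x); first by exists x.
  by exists x0; split=> //; apply/ltW/(tag_lt hT); rewrite x00.
have [z [_ zy zl]] := tag_coinitial hT c0 ab y0.
by exists z; split=> //; apply: lt_le_trans zy yx.
Qed.

Lemma colow_tag0 a x : c 0 = OmegaRev a -> tg x = 0%N -> colow a x.
Proof.
move=> c0 x0; have a0 := code_rev hc c0.
have tg0 y : y <= x -> tg y = 0%N.
  by move=> yx; apply/eqP; rewrite -leqn0 -x0 (tag_le hT yx).
split=> [y yx|]; first exact: (tag_has_pred hT c0 a0 (tg0 y yx)).
split=> [y yx|y yx [z [yz [zx zl]]]].
  exact: (tag_nrlim hT c0 (tg0 y (ltW yx)) x0 yx).
(* In the reversed order this yields the least limit from the right between [y] and [x]. The point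
   [x] is left out, as [colow] does, because it may owe its rank to the next term. *)
have := @llim1_max _ T^d (fun u : T => tg u = 0%N /\ u < x) y; case.
- move=> P [x1 [[x10 x1x] Px1]].
  have [|u [u0 [ux Pu] umax]] := tag_cowf hT c0 (P := fun u => u < x /\ P u).
    by exists x1.
  by exists u; split=> // w [w0 wx] Pw; apply: umax.
- move=> u v w [u0 ux] _ vu _; have vx := @le_lt_trans _ T _ _ _ vu ux.
  by split=> //; apply/tg0/ltW.
- by split=> //; apply/tg0/ltW.
- by exists z; split=> //; split=> //; apply/tg0/ltW.
move=> u [[_ ux] yu ul umin]; exists u; do ![split=> //] => w yw wx wl.
by apply: umin => //; split=> //; apply/tg0/ltW.
Qed.

(** If a reversed power follows, its exponent is at least [a], so the last point of the first term
    has rank [a] from the right and nothing after it qualifies. If $\omega^b$ follows and [x] lies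
    beyond it, then [b > 1] gives a limit without predecessor. For [b = 1] so does the first point
    of a third term that is a power; a third term that is a reversed power has exponent above 1 by
    specialness, and its limits from the right have no least one. *)
Lemma colow_tag_le1 a x : c 0 = OmegaRev a -> colow a x ->
  tg x = 0%N \/ (tg x = 1%N /\ is_omega (c 1)).
Proof.
move=> c0 [xpred [nrl rmin]]; have a0 := code_rev hc c0.
have [|x1] := posnP (tg x); [by left|right].
have [y [y0 ymax]] := tag_max hT c0.
have yx : y < x by apply: (tag_lt hT); rewrite y0.
case c1: (c 1%N) => [b|b]; last first.
  case: (nrl y yx); apply: (@rlim_le _ b); first exact: (code_asc hc c0 c1).
  by apply: (tag_max_rlim hT c1 y0) => z z0; apply: ymax; rewrite z0.
split=> //; apply/eqP; rewrite eqn_leq x1 andbT leqNgt; apply/negP => x2.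
have b0 := code_turn hc c0 c1.
have [w w1] := tag_surj hT 1.
have wx : w < x by apply: (tag_lt hT); rewrite w1.
have [b1|b1] := ltnP 1 b.
  have [z [z1 _ zl]] := tag_cofinal hT c1 b1 w1.
  by apply: (has_pred_llim _ zl); apply/xpred/ltW/(tag_lt hT); rewrite z1.
have {b1 b0} b1 : b = 1%N by apply/eqP; rewrite eqn_leq b1.
rewrite {}b1 in c1; case c2: (c 2%N) => [e|e].
  have [z [z2 zmin]] := tag_min hT c2.
  apply: (@has_pred_llim _ T z); first by apply/xpred/zmin.
  by apply: (tag_min_llim hT c1 z2) => u u2; apply: zmin; rewrite u2.
have e1 : (1 < e)%N.
  case: e c2 => [|[|//]] c2; first by have := code_rev hc c2.
  by case: (code_special_rev hc a0 c0 c1 c2).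
have [u [u2 ux]] : exists u, tg u = 2%N /\ u <= x.
  move: x2; rewrite leq_eqVlt => /predU1P[x2|x2]; first by exists x.
  have [u u2] := tag_surj hT 2.
  by exists u; split=> //; apply/ltW/(tag_lt hT); rewrite u2.
have [v [v2 vu vl]] := tag_coinitial hT c2 e1 u2.
have [|z [wz [zx [zl zmin]]]] := rmin w wx.
  exists v; split; first by apply/ltW/(tag_lt hT); rewrite w1 v2.
  by split=> //; apply: lt_le_trans vu ux.
have zv : z <= v.
  apply: zmin => //; last exact: lt_le_trans vu ux.
  by apply/ltW/(tag_lt hT); rewrite w1 v2.
have := tag_le hT zv; rewrite v2 leq_eqVlt => /predU1P[z2|z1].
  have [v' [v'2 v'z v'l]] := tag_coinitial hT c2 e1 z2.
  suff : z <= v' by rewrite leNgt v'z.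
  apply: zmin => //; first by apply/ltW/(tag_lt hT); rewrite w1 v'2.
  exact: lt_trans v'z zx.
have {}z1 : tg z = 1%N by apply/eqP; rewrite eqn_leq -ltnS z1 -w1 (tag_le hT wz).
exact: has_succ_rlim (tag_has_succ hT c1 isT z1) zl.
Qed.

End Codes.

(** * Sums of monomials *)

Definition coded (c : monomial) (d : Order.disp_t) (T : orderType d) : Prop :=
  match c with
  | Omega a => order_iso T (omega_pow a)
  | OmegaRev a => order_iso T (omega_pow_rev a)
  end.

Section Osum.
Variables (d : Order.disp_t) (t : nat -> orderType d).

Lemma lt_Tagged i : {mono (fun x : t i => Tagged t x : osum t) : x y / x < y}.
Proof. by move=> x y; rewrite ltEsig /= lexx tagged_asE. Qed.

Lemma osum_tag_lt (x y : osum t) : (tag x < tag y)%N -> x < y.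
Proof. by move=> xy; rewrite ltEsig !leEnat (ltnW xy) leqNgt xy. Qed.

Lemma osum_tag_le (x y : osum t) : x <= y -> (tag x <= tag y)%N.
Proof. by rewrite leEsig => /andP[]. Qed.

Lemma osum_tagP i (x : osum t) : tag x = i <-> exists y : t i, x = Tagged t y.
Proof. by split=> [<-|[y ->]] //; exists (tagged x); case: x. Qed.

Lemma blocks_osum (c : nat -> monomial) :
  (forall i, coded (c i) (t i)) -> blocks (fun x : osum t => tag x) c.
Proof.
move=> ht; split; first exact: osum_tag_le.
  move=> i; suff [x] : exists x : t i, True by exists (Tagged t x).
  have := ht i; case: (c i) => a [f [[g _ _] _]].
  - by exists (g [tuple of nseq a 0%N]).
  - by exists (g [tuple of nseq a 0%N]).
move=> i; have := ht i; rewrite /coded.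
have conv (x y : t i) (z : osum t) : Tagged t x < z -> z < Tagged t y ->
    exists w : t i, z = Tagged t w.
  move=> xz zy; apply/osum_tagP/eqP; rewrite eqn_leq.
  by rewrite (osum_tag_le (ltW zy)) (osum_tag_le (ltW xz)).
case: (c i) => a /order_iso_sym[f [[g gK fK] fmono]].
- apply: (@block_embed a _ _ (omega_pow a) (osum t) (fun x => Tagged t (f x))).
  + by move=> x y; rewrite lt_Tagged (leW_mono fmono).
  + move=> x y z xz zy; have [w ->] := conv _ _ _ xz zy.
    by exists (g w); rewrite fK.
  + move=> x; rewrite osum_tagP; split=> [[y ->]|[y ->]]; last by exists (f y).
    by exists (g y); rewrite fK.
  + exact: block_omega_pow.
- apply: (@block_embed a _ _ (omega_pow a) (osum t)^d (fun x => Tagged t (f x))).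
  + move=> x y; rewrite ltEdual lt_Tagged.
    exact: (leW_mono fmono).
  + move=> x y z xz zy; have [w ->] := conv _ _ _ zy xz.
    by exists (g w); rewrite fK.
  + move=> x; rewrite osum_tagP; split=> [[y ->]|[y ->]]; last by exists (f y).
    by exists (g y); rewrite fK.
  + exact: block_omega_pow.
Qed.

Definition osum_shift (x : osum (t \o succn)) : osum t := Tagged t (tagged x).

Lemma osum_shift_mono : {mono osum_shift : x y / x < y}.
Proof.
move=> [i x] [j y]; rewrite !ltEsig /= !leEnat !ltnS.
case: (ltngtP i j) => //= ij; case: _ / ij y => y.
by rewrite /= !tagged_asE.
Qed.

Lemma osum_shiftP (x : osum t) : (0 < tag x)%N <-> exists y, x = osum_shift y.
Proof.
split=> [|[y ->] //]; case: x => -[//|i] x _.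
by exists (Tagged (t \o succn) (x : (t \o succn) i)).
Qed.

(** Only the first term is cut, and its part from [y] on is again $\omega^a$; all later terms stay
    fixed. *)
Lemma osum_final a (y : osum t) : order_iso (t 0) (omega_pow a) -> tag y = 0%N ->
  exists F : osum t -> osum t,
    {mono F : x y / x < y} /\ forall z, y <= z <-> exists w, z = F w.
Proof.
move=> [e [[e' eK e'K] emono]] /osum_tagP[y0 ->].
have [f [fmono fP]] := omega_pow_final (e y0).
pose g := e' \o f \o e.
have e'mono : {mono e' : x y / x < y}.
  by move=> u v; rewrite -(leW_mono emono) !e'K.
have gmono : {mono g : x y / x < y}.
  by move=> u v; rewrite e'mono fmono (leW_mono emono).
have gP z : y0 <= z <-> exists w, z = g w.
  rewrite -emono fP; split=> [[w ew]|[w ->]]; last by exists (e w); rewrite e'K.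
  by exists (e' w); rewrite /g /= e'K -ew eK.
pose F (x : osum t) : osum t :=
  match tag x as i return t i -> osum t with
  | 0 => fun v => Tagged t (g v)
  | _.+1 => fun v => Tagged t v
  end (tagged x).
exists F; split.
  by move=> [[|i] u] [[|j] v]; rewrite ?lt_Tagged // ltEsig /= ?tagged_asE.
move=> [[|i] z].
  rewrite leNgt lt_Tagged -leNgt gP; split=> [[w ->]|[[[|j] w] zE]].
  - by exists (Tagged t w).
  - by exists w; move: zE; rewrite /F /= => /eqP; rewrite eq_Tagged => /eqP.
  - by move: zE => /(congr1 (@tag _ _)).
split=> [_|_]; last by apply/ltW/osum_tag_lt.
by exists (Tagged t z).
Qed.

End Osum.

Lemma special_codeS c : special_code c -> special_code (c \o succn).
Proof.
case=> *; split=> /=; eauto.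
Qed.

(** * Reading off the terms from the theory *)

Lemma osum_shift2_mono d (t : nat -> orderType d) :
  {mono (fun y : osum (t \o succn \o succn) => osum_shift (osum_shift y)) :
    x y / x < y}.
Proof. by move=> x y; rewrite !osum_shift_mono. Qed.

Definition has_min (d : Order.disp_t) (T : orderType d) : Prop :=
  exists x : T, forall y, x <= y.

Lemma has_min_elem_equiv d d' (A : orderType d) (B : orderType d') :
  elem_equiv A B -> has_min A -> has_min B.
Proof.
move=> AB; apply: (elem_equiv_definable (Q := has_min) AB).
rewrite /has_min; definability.
Qed.

(** Restricting to these points removes a one-point first term, but leaves a sum starting with an
    infinite power of $\omega$ unchanged up to isomorphism. *)
Definition non_min (d : Order.disp_t) (T : orderType d) (x : T) : Prop :=
  exists y, y < x.

Lemma definable_non_min V (i : V) : definable (fun _ _ v => non_min (v i)).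
Proof. rewrite /non_min; definability. Qed.

(** * Tails of a single sum *)

Section Step.
Variables (d : Order.disp_t) (t : nat -> orderType d) (c : nat -> monomial).
Hypotheses (ht : forall i, coded (c i) (t i)) (hc : special_code c).

Let hT := blocks_osum ht.

Lemma omega0_non_min : c 0 = Omega 0 -> forall x : osum t,
  non_min x <-> exists y, x = osum_shift y.
Proof.
move=> c0 x; rewrite -osum_shiftP; split=> [[y yx]|x0].
  rewrite lt0n; apply/eqP => x0; apply: (tag_nlim hT c0 x0 _ yx) => //.
  by apply/eqP; rewrite -leqn0 -x0 (tag_le hT (ltW yx)).
by have [y y0] := tag_surj hT 0; exists y; apply: (tag_lt hT); rewrite y0.
Qed.

(** The second point of the sum still lies in $\omega^a$, so [osum_final] applies to it. *)
Lemma omega_non_min a : c 0 = Omega a -> (0 < a)%N ->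
  exists F : osum t -> osum t,
    {mono F : x y / x < y} /\ forall x, non_min x <-> exists y, x = F y.
Proof.
move=> c0 a0; have [x [x0 xmin]] := tag_min hT c0.
have [y [y0 xy ymin]] : exists y, [/\ tag y = 0%N, x < y & forall z, x < z -> y <= z].
  have [y [xy ymin]] := tag_has_succ hT c0 a0 x0.
  have [z [z0 xz _]] := tag_cofinal hT c0 a0 x0.
  by exists y; split=> //; apply/eqP; rewrite -leqn0 -z0 (tag_le hT (ymin z xz)).
have t0 : order_iso (t 0) (omega_pow a) by have := ht 0; rewrite c0.
have [F [Fmono FP]] := osum_final t0 y0.
exists F; split=> // z; rewrite -FP; split=> [[w wz]|yz].
  by apply: ymin; apply: le_lt_trans wz; apply: xmin.
by exists x; apply: lt_le_trans yz.
Qed.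

Lemma not_low_shift a : c 0 = Omega a -> (0 < a)%N ->
  ~ (a = 1%N /\ c 1 = OmegaRev 1) ->
  forall x : osum t, ~ low a x <-> exists y, x = osum_shift y.
Proof.
move=> c0 a0 nexc x; rewrite (low_tag hT hc x c0 a0 nexc) -osum_shiftP ltnNge.
by split=> [/negP|/negP].
Qed.

Lemma not_low_shift2 : c 0 = Omega 1 -> c 1 = OmegaRev 1 ->
  forall x : osum t, ~ low 1 x <->
    exists y : osum (t \o succn \o succn), x = osum_shift (osum_shift y).
Proof.
move=> c0 c1 x; rewrite (low_tag_exceptional hT hc x c0 c1).
split=> [/negP|[y ->] //]; rewrite -ltnNge => x1.
have /osum_shiftP[y xE] : (0 < tag x)%N by apply: ltn_trans x1.
have /osum_shiftP[z yE] : (0 < tag y)%N by rewrite xE in x1.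
by exists z; rewrite xE yE.
Qed.

(** The theory of the tail is recovered one sentence at a time: [psi] has to hold strictly after
    every sufficiently late point of [colow a], which does not require the exact cut to be
    definable. *)
Definition colow_tail (a : nat) (psi : formula void) d (T : orderType d) : Prop :=
  exists x : T, colow a x /\ forall y, colow a y -> x <= y ->
    rsat (fun z => y < z) (@of_void T) psi.

Lemma definable_colow_tail a psi : definable (V := void)
  (fun _ T _ => colow_tail a psi T).
Proof.
apply: definable_exists; apply: definable_and; first exact: definable_colow.
apply: definable_forall; apply: definable_imp; first exact: definable_colow.
apply: definable_imp; first exact: definable_le.
have := @definable_rsat unit (fun _ _ v z => v tt < z) void psi
  (option (option void)) (fun=> None) (@of_void _) _.
case=> [V p i|phi phiP]; first exact: definable_lt.
exists phi => d' T v; rewrite phiP.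
by suff -> : (fun w => v (of_void _ w)) = of_void T by []; apply: funext; case.
Qed.

(* A point y of the second term omega^b has a successor s, and [s, oo) is
   isomorphic to the sum without its first term. *)
Lemma colow_tailP a psi : c 0 = OmegaRev a ->
  models (osum (t \o succn)) psi <-> colow_tail a psi (osum t).
Proof.
move=> c0; have [x [x0 xmax]] := tag_max hT c0.
have tail (y : osum t) : x <= y -> colow a y -> models (osum (t \o succn)) psi <->
    rsat (fun z => y < z) (@of_void (osum t)) psi.
  move=> xy yl; have [y0|[y1]] := colow_tag_le1 hT hc c0 yl.
    apply: (models_embed _ (@osum_shift_mono _ t)) => z.
    rewrite -osum_shiftP; split=> [yz|z0]; last by apply: (tag_lt hT); rewrite y0.
    rewrite ltnNge; apply/negP => z0.
    by have := lt_le_trans (le_lt_trans xy yz) (xmax _ z0); rewrite ltxx.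
  move=> /is_omegaP[b c1]; have b0 := code_turn hc c0 c1.
  have [s [ys smin]] := tag_has_succ hT c1 b0 y1.
  have s1 : tag s = 1%N.
    have [z [z1 yz _]] := tag_cofinal hT c1 b0 y1.
    apply/eqP; rewrite eqn_leq; apply/andP; split.
      by rewrite -z1; apply: (tag_le hT); apply: smin.
    by rewrite -y1; apply: (tag_le hT); apply: ltW.
  have /osum_shiftP[s' sE] : (0 < tag s)%N by rewrite s1.
  have t1 : order_iso ((t \o succn) 0) (omega_pow b) by have := ht 1; rewrite c1.
  have s'0 : tag s' = 0%N by move: s1; rewrite sE => -[].
  have [F [Fmono FP]] := osum_final t1 s'0.
  apply: (@models_embed _ _ (osum (t \o succn)) (osum t) (@osum_shift _ t \o F)).
    by move=> u v /=; rewrite osum_shift_mono Fmono.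
  move=> z; split=> [yz|[w ->]].
    have sz := smin z yz.
    have /osum_shiftP[z' zE] : (0 < tag z)%N by rewrite -s1 (tag_le hT sz).
    have /FP[w wE] : s' <= z' by rewrite leNgt -osum_shift_mono -zE -sE -leNgt.
    by exists w; rewrite zE wE.
  apply: lt_le_trans ys _; rewrite sE leNgt osum_shift_mono -leNgt.
  by apply/FP; exists w.
have xl : colow a x by apply: colow_tag0 c0 x0.
split=> [H|[x' [x'l H]]].
  by exists x; split=> // y yl xy; apply/(tail y xy yl).
(* The point [x'] may precede the end of the first term; its maximum with the last point [x] of that
   term is a cut to which [tail] applies. *)
have yl : colow a (Order.max x x') by case: leP.
by apply/(tail _ _ yl); [|apply: H]; rewrite // le_max lexx ?orbT.
Qed.

End Step.

(** * Comparison of two sums *)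

Section Compare.
Variables (d d' : Order.disp_t).
Implicit Types (t : nat -> orderType d) (u : nat -> orderType d').
Implicit Types (c e : nat -> monomial).

(** Delete the least point from both sums [j] times. The first sum loses its one-point terms, while
    the second returns to itself up to isomorphism. In the end the first has no least point and the
    second has one. *)
Lemma ones_then_omega_rev j t u c e f b :
  (forall i, coded (c i) (t i)) -> (forall i, coded (e i) (u i)) ->
  special_code c -> (forall i, (i < j)%N -> c i = Omega 0) -> c j = OmegaRev f ->
  e 0 = Omega b -> (0 < b)%N -> ~ elem_equiv (osum t) (osum u).
Proof.
elim: j t c => [|j IHj] t c ht hu hc c0 cj e0 b0 AB.
  apply: (omega_rev_no_min (blocks_osum ht) hc cj).
  apply: (has_min_elem_equiv (elem_equiv_sym AB)).
  exact: (omega_has_min (blocks_osum hu) e0).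
apply: (IHj (t \o succn) (c \o succn)) => //.
- by move=> i; apply: ht.
- exact: special_codeS.
- by move=> i ij; apply: c0.
have [F [Fmono FP]] := omega_non_min hu e0 b0.
apply: (elem_equiv_restrict definable_non_min (@osum_shift_mono _ t) _ Fmono FP AB).
exact: (omega0_non_min ht (c0 0%N isT)).
Qed.

(** If all terms of the first sum are single points, [low 1] holds everywhere in it but not in the
    second. Otherwise the first other term is a reversed power, because exponents cannot rise from 0
    in a run of powers. *)
Lemma one_omega_pow t u c e b :
  (forall i, coded (c i) (t i)) -> (forall i, coded (e i) (u i)) ->
  special_code c -> special_code e ->
  c 0 = Omega 0 -> e 0 = Omega b -> (0 < b)%N -> ~ elem_equiv (osum t) (osum u).
Proof.
move=> ht hu hc he c0 e0 b0 AB.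
have [all0|] := EM (forall i, c i = Omega 0).
  have [x] := omega_not_low1 (blocks_osum hu) he e0 b0; apply.
  move: x; apply: (elem_equiv_definable
    (Q := fun d T => forall x : T, low 1 x) AB).
    by apply: definable_forall; apply: definable_low.
  move=> x; apply: (run_low (blocks_osum ht) hc c0 (isT : (0 < 1)%N)) => i _.
  by rewrite all0.
move=> /existsNP[i0 i0P].
have ex : exists i, `[< c i <> Omega 0 >] by exists i0; apply/asboolP.
case: (ex_minnP ex) => j /asboolP jP jmin.
have ones i : (i < j)%N -> c i = Omega 0.
  move=> ij; apply: contrapT => iP.
  by have := jmin i (asboolT iP); rewrite leqNgt ij.
case cj: (c j) => [a|f]; last exact: (ones_then_omega_rev ht hu hc ones cj e0 b0 AB).
case: j cj jP ones {jmin} => [|j] cj jP ones; first by apply: jP; rewrite c0.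
have := code_desc hc (ones j (ltnSn j)) cj; rewrite leqn0 => /eqP a0.
by apply: jP; rewrite cj a0.
Qed.

End Compare.

Lemma compare_first d d' (t : nat -> orderType d) (u : nat -> orderType d')
    (c e : nat -> monomial) :
  (forall i, coded (c i) (t i)) -> (forall i, coded (e i) (u i)) ->
  special_code c -> special_code e -> elem_equiv (osum t) (osum u) ->
  c 0 = e 0 /\
  (elem_equiv (osum (t \o succn)) (osum (u \o succn)) \/
   c 1 = e 1 /\ elem_equiv (osum (t \o succn \o succn)) (osum (u \o succn \o succn))).
Proof.
move=> ht hu hc he AB; have BA := elem_equiv_sym AB.
have hT := blocks_osum ht; have hU := blocks_osum hu.
case c0: (c 0) => [a|a]; case e0: (e 0) => [b|b]; last first.
- have ab : a = b.
    have rl k : (forall x : osum t, exists y, y < x /\ rlim k y) <->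
        (forall x : osum u, exists y, y < x /\ rlim k y).
      have def : definable (V := void)
          (fun d T _ => forall x : T, exists y, y < x /\ rlim k y) by definability.
      by split; apply: (elem_equiv_definable
        (Q := fun d T => forall x : T, exists y, y < x /\ rlim k y) _ def).
    apply/eqP; rewrite eqn_leq; apply/andP; split; rewrite leqNgt; apply/negP.
      move=> /(omega_rev_rlim hT b c0)/rl/(omega_rev_rlim hU b e0).
      by rewrite ltnn.
    move=> /(omega_rev_rlim hU a e0)/rl/(omega_rev_rlim hT a c0).
    by rewrite ltnn.
  subst b; split=> //; left=> psi.
  rewrite (colow_tailP ht hc psi c0) (colow_tailP hu he psi e0).
  by split; apply: (elem_equiv_definable (Q := @colow_tail a psi) _
    (definable_colow_tail a psi)).
- case: (omega_rev_no_min hT hc c0); apply: (has_min_elem_equiv BA).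
  exact: (omega_has_min hU e0).
- case: (omega_rev_no_min hU he e0); apply: (has_min_elem_equiv AB).
  exact: (omega_has_min hT c0).
(* The description of the first term by [low] needs a positive exponent; a one-point term is removed
   by [non_min] instead. *)
have [a0|a0] := posnP a.
  rewrite a0 in c0 *; have [b0|b0] := posnP b; last first.
    by case: (one_omega_pow ht hu hc he c0 e0 b0 AB).
  rewrite b0 in e0 *; split=> //; left.
  exact: (elem_equiv_restrict definable_non_min (@osum_shift_mono _ t)
    (omega0_non_min ht c0) (@osum_shift_mono _ u) (omega0_non_min hu e0) AB).
have [b0|b0] := posnP b.
  by rewrite b0 in e0; case: (one_omega_pow hu ht he hc e0 c0 a0 BA).
have not_low k V (i : V) : definable (fun _ _ v => ~ low k (v i)).
  exact/definable_not/definable_low.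
have startAB k : omega_start k (osum t) -> omega_start k (osum u).
  exact: (elem_equiv_definable (Q := omega_start k) AB (definable_omega_start k)).
have startBA k : omega_start k (osum u) -> omega_start k (osum t).
  exact: (elem_equiv_definable (Q := omega_start k) BA (definable_omega_start k)).
case: a c0 a0 => // a c0 _; case: b e0 b0 => // b e0 _.
have [[a1 c1]|ca] := EM (a = 0 /\ c 1 = OmegaRev 1)%N;
have [[b1 e1]|eb] := EM (b = 0 /\ e 1 = OmegaRev 1)%N.
- rewrite a1 in c0 *; rewrite b1 in e0 *; split=> //; right; split; first by rewrite c1.
  exact: (elem_equiv_restrict (D := fun d T x => ~ low 1 x) (not_low 1%N)
    (osum_shift2_mono (t := t)) (not_low_shift2 ht hc c0 c1)
    (osum_shift2_mono (t := u)) (not_low_shift2 hu he e0 e1) AB).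
(* If only one sum starts with $\omega + \omega^*$, the other satisfies [omega_start] for some
   exponent, which the first cannot. *)
- have [H _] := omega_start_ge hT hc c0 isT (startBA _ (omega_start_holds hU he e0 eb)).
  by case: H; split; rewrite ?a1.
- have [H _] := omega_start_ge hU he e0 isT (startAB _ (omega_start_holds hT hc c0 ca)).
  by case: H; split; rewrite ?b1.
have [nexc ba] := omega_start_ge hT hc c0 isT (startBA _ (omega_start_holds hU he e0 eb)).
have [nexe ab] := omega_start_ge hU he e0 isT (startAB _ (omega_start_holds hT hc c0 ca)).
have abE : a = b by apply/eqP; rewrite eqn_leq -ltnS ab -ltnS ba.
rewrite {}abE in c0 nexc *; split=> //; left.
exact: (elem_equiv_restrict (D := fun d T x => ~ low b.+1 x) (not_low b.+1)
  (@osum_shift_mono _ t)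
  (not_low_shift ht hc c0 isT nexc) (@osum_shift_mono _ u)
  (not_low_shift hu he e0 isT nexe) AB).
Qed.

(** Strong induction on [k], as [compare_first] may strip two terms at once. *)
Lemma elem_equiv_code k d d' (t : nat -> orderType d) (u : nat -> orderType d')
    (c e : nat -> monomial) :
  (forall i, coded (c i) (t i)) -> (forall i, coded (e i) (u i)) ->
  special_code c -> special_code e -> elem_equiv (osum t) (osum u) -> c k = e k.
Proof.
have [n kn] := ubnP k; elim: n k t u c e kn => // n IHn k t u c e kn ht hu hc he AB.
have [ce0 tails] := compare_first ht hu hc he AB.
case: k kn => [|k] kn //; rewrite ltnS in kn.
case: tails => [tails|[ce1 tails]].
  apply: (IHn k (t \o succn) (u \o succn) (c \o succn) (e \o succn)) => //;
    by [move=> i; apply: ht|move=> i; apply: hu|apply: special_codeS].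
case: k kn => [|k] kn //.
apply: (IHn k (t \o succn \o succn) (u \o succn \o succn)
  (c \o succn \o succn) (e \o succn \o succn)) => //.
- exact: ltnW.
- by move=> i; apply: ht.
- by move=> i; apply: hu.
- by do 2!apply: special_codeS.
- by do 2!apply: special_codeS.
Qed.

(** Each inequality between neighbouring exponents is forced because its failure would let one term
    absorb the other. For [code_turn] the single point is read as a reversed power of exponent 0,
    which the reversed power before it absorbs. *)
Lemma special_monomial_code d (t : nat -> orderType d) (m : nat -> nat) :
  (forall i, order_iso (t i) (omega_pow (m i)) \/
             order_iso (t i) (omega_pow_rev (m i))) ->
  monomial_sum t -> special t ->
  exists c, (forall i, coded (c i) (t i)) /\ special_code c.
Proof.
move=> ht tmono tspec.
have /choice[c cP] : forall i, exists c, coded c (t i) /\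
    (forall a, c = OmegaRev a -> (0 < a)%N).
  move=> i; have [ti|ti] := ht i; first by exists (Omega (m i)).
  have [m0|m0] := posnP (m i); last by exists (OmegaRev (m i)); split=> // a [<-].
  exists (Omega 0); split=> //; rewrite m0 in ti.
  exact: order_iso_trans ti omega_pow_rev0.
exists c; split=> [i|]; first by have [] := cP i.
have cO i a : c i = Omega a -> order_iso (t i) (omega_pow a).
  by have [+ _] := cP i => /[swap] ->.
have cR i a : c i = OmegaRev a -> order_iso (t i) (omega_pow_rev a).
  by have [+ _] := cP i => /[swap] ->.
have crev i a : c i = OmegaRev a -> (0 < a)%N by have [_] := cP i; apply.
split=> //.
- move=> i a b /cO ca /cO cb; rewrite leqNgt; apply/negP => ab.
  by have [_] := tmono i; apply; apply: omega_pow_absorb ab ca cb.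
- move=> i a b /cR ca /cR cb; rewrite leqNgt; apply/negP => ab.
  by have [+ _] := tmono i; apply; apply: omega_pow_rev_absorb ab cb ca.
- move=> i a b ca /cO cb; rewrite lt0n; apply/eqP => b0; rewrite b0 in cb.
  have [+ _] := tmono i; apply; apply: omega_pow_rev_absorb (crev _ _ ca) _ (cR _ _ ca).
  exact: order_iso_trans cb (order_iso_sym omega_pow_rev0).
- move=> i k k0 /cO c0 /cR c1 /cO c2; have [+ _] := tspec i k k0; apply; split=> //.
  + exact: order_iso_trans c0 omega_pow1.
  + exact: order_iso_trans c1 omega_pow_rev1.
- move=> i k k0 /cR c0 /cO c1 /cR c2; have [_] := tspec i k k0; apply; split=> //.
  + exact: order_iso_trans c1 omega_pow1.
  + exact: order_iso_trans c2 omega_pow_rev1.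
Qed.

Lemma order_iso_osum d d' (t : nat -> orderType d) (u : nat -> orderType d') :
  (forall i, order_iso (t i) (u i)) -> order_iso (osum t) (osum u).
Proof.
move=> tu; have f i := cid (tu i).
have fmono i : {mono sval (f i) : x y / x <= y} by have [_] := svalP (f i).
have fsurj i (y : u i) : exists x, y = sval (f i) x.
  by have [[g _ gK] _] := svalP (f i); exists (g y).
apply: (@order_iso_surj _ _ _ _
  (fun x : osum t => Tagged u (sval (f (tag x)) (tagged x)) : osum u)).
  move=> [i x] [j y]; rewrite !ltEsig /= !leEnat; case: (ltngtP i j) => //= ij.
  by case: _ / ij y => y; rewrite !tagged_asE (leW_mono (fmono i)).
by move=> [i y]; have [x ->] := fsurj i y; exists (Tagged t x).
Qed.

Theorem theorem4p5 (d d' : Order.disp_t)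
    (t : nat -> orderType d) (u : nat -> orderType d') (m n : nat -> nat)
    (ht : forall i, order_iso (t i) (omega_pow (m i)) \/
                    order_iso (t i) (omega_pow_rev (m i)))
    (hu : forall i, order_iso (u i) (omega_pow (n i)) \/
                    order_iso (u i) (omega_pow_rev (n i)))
    (t_monomial : monomial_sum t) (t_special : special t)
    (u_monomial : monomial_sum u) (u_special : special u) :
  order_iso (osum t) (osum u) <-> elem_equiv (osum t) (osum u).
Proof.
split=> [|AB]; first exact: elem_equiv_iso.
have [c [ct hc]] := special_monomial_code ht t_monomial t_special.
have [e [eu he]] := special_monomial_code hu u_monomial u_special.
apply: order_iso_osum => i.
have := ct i; rewrite (elem_equiv_code i ct eu hc he AB).
have := eu i; rewrite /coded; case: (e i) => a ua ta;
  exact: order_iso_trans ta (order_iso_sym ua).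
Qed.
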